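(* Let $(\gamma,\widetilde\gamma)$ be a non-helical and non-planar Bertrand pair in Euclidean 3-space ($\gamma$ the Bertrand curve). Then the following are equivalent: (i) the tangent indicatrix $\gamma_t=T$ of $\gamma$ is a spherical helix; (ii) the principal normal indicatrix $\gamma_n=N$ of $\gamma$ is planar; (iii) the binormal indicatrix $\gamma_b=B$ of $\gamma$ is a spherical helix.
   Context: Curves are smooth regular curves in $\mathbb{R}^3$ with non-vanishing curvature; $\gamma$ is parameterized by arclength $s$ with Frenet frame $T,N,B$, curvature $\kappa$, torsion $\tau$, and $\widetilde\gamma$ by arclength $s^{*}$ with $\widetilde T,\widetilde N,\widetilde B,\widetilde\kappa,\widetilde\tau$. The pair $(\gamma,\widetilde\gamma)$ is a Bertrand pair if there is a correspondence of points such that the principal normals at corresponding points are linearly dependent, $N=\epsilon\widetilde N$ with $\epsilon=\pm1$, and $\widetilde\gamma(s^{*})=\gamma(s)+\lambda N(s)$ with $\lambda\neq0$ constant. Non-helical means that torsion/curvature of each curve is not constant, non-planar that the torsions are non-zero; the quotients $\tau/\kappa$, $\tau'/\kappa'$, $\widetilde\tau/\widetilde\kappa$, $\widetilde\tau'/\widetilde\kappa'$ are assumed to be defined (denominators non-zero, and the two quotients of each curve different and non-zero at each point). The tangent, principal normal and binormal indicatrices of $\gamma$ are the curves $s\mapsto T(s)$, $N(s)$, $B(s)$ on the unit sphere. A spherical helix is a curve on the sphere which is a (general) helix, i.e. the ratio of its torsion to its curvature is constant; a curve is planar if it lies in a plane. *)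

(* Defs.v *)
From Stdlib Require Import Reals.
From Coquelicot Require Import Coquelicot.
Open Scope R_scope.

Notation R3 := (R * R * R)%type.

Definition px (v : R3) : R := fst (fst v).
Definition py (v : R3) : R := snd (fst v).
Definition pz (v : R3) : R := snd v.

Definition dot (u v : R3) : R := px u * px v + py u * py v + pz u * pz v.

(* Euclidean length; Coquelicot's [norm] on a product is only a norm
   equivalent to it. *)
Definition vnorm (u : R3) : R := sqrt (dot u u).

Definition cross (u v : R3) : R3 :=
  (py u * pz v - pz u * py v,
   pz u * px v - px u * pz v,
   px u * py v - py u * px v).

Definition vderive (f : R -> R3) (t : R) : R3 :=
  (Derive (fun x => px (f x)) t,
   Derive (fun x => py (f x)) t,
   Derive (fun x => pz (f x)) t).

(* Parameter domains are open intervals ]a, b[, bounded or not. *)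
Definition in_itv (a b : Rbar) (t : R) : Prop := Rbar_lt a t /\ Rbar_lt t b.

Definition smooth_on (a b : Rbar) (f : R -> R) : Prop :=
  forall (n : nat) (t : R), in_itv a b t -> ex_derive_n f n t.

Definition vsmooth_on (a b : Rbar) (f : R -> R3) : Prop :=
  smooth_on a b (fun t => px (f t)) /\
  smooth_on a b (fun t => py (f t)) /\
  smooth_on a b (fun t => pz (f t)).

(* Frenet apparatus of a regular curve in an arbitrary parameter t: the
   derivative with respect to arclength is d/ds = (1 / speed) d/dt.
   The indicatrices tangent f, normal f and binormal f are in general not
   parameterized by arclength, even when f is. *)
Definition speed (f : R -> R3) (t : R) : R := vnorm (vderive f t).

Definition tangent (f : R -> R3) (t : R) : R3 :=
  scal (/ speed f t) (vderive f t).

Definition curvature (f : R -> R3) (t : R) : R :=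
  vnorm (vderive (tangent f) t) / speed f t.

Definition normal (f : R -> R3) (t : R) : R3 :=
  scal (/ vnorm (vderive (tangent f) t)) (vderive (tangent f) t).

Definition binormal (f : R -> R3) (t : R) : R3 :=
  cross (tangent f t) (normal f t).

(* Sign convention dB/ds = - torsion * N. *)
Definition torsion (f : R -> R3) (t : R) : R :=
  - dot (vderive (binormal f) t) (normal f t) / speed f t.

Definition curve (a b : Rbar) (f : R -> R3) : Prop :=
  vsmooth_on a b f /\
  (forall t : R, in_itv a b t -> speed f t <> 0) /\
  (forall t : R, in_itv a b t -> curvature f t <> 0).

Definition arclength_curve (a b : Rbar) (f : R -> R3) : Prop :=
  curve a b f /\ (forall s : R, in_itv a b s -> speed f s = 1).

Definition helix (a b : Rbar) (f : R -> R3) : Prop :=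
  curve a b f /\
  exists k : R, forall t : R, in_itv a b t -> torsion f t / curvature f t = k.

Definition spherical_helix (a b : Rbar) (f : R -> R3) : Prop :=
  (forall t : R, in_itv a b t -> vnorm (f t) = 1) /\ helix a b f.

Definition planar (a b : Rbar) (f : R -> R3) : Prop :=
  exists (u : R3) (k : R),
    u <> (0, 0, 0) /\ forall t : R, in_itv a b t -> dot u (f t) = k.

(* The correspondence of points is a change of parameter s* = phi s, a
   diffeomorphism of ]a, b[ onto ]c, d[ of either orientation. *)
Definition correspondence (a b c d : Rbar) (phi : R -> R) : Prop :=
  smooth_on a b phi /\
  (forall s : R, in_itv a b s -> Derive phi s <> 0) /\
  (forall s : R, in_itv a b s -> in_itv c d (phi s)) /\
  (forall s' : R, in_itv c d s' -> exists s : R, in_itv a b s /\ phi s = s').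

Definition bertrand_pair (a b : Rbar) (g : R -> R3)
    (c d : Rbar) (g' : R -> R3) : Prop :=
  arclength_curve a b g /\
  arclength_curve c d g' /\
  exists (phi : R -> R) (eps lam : R),
    correspondence a b c d phi /\
    (eps = 1 \/ eps = -1) /\
    lam <> 0 /\
    (forall s : R, in_itv a b s -> normal g s = scal eps (normal g' (phi s))) /\
    (forall s : R, in_itv a b s ->
       g' (phi s) = plus (g s) (scal lam (normal g s))).

Definition non_helical (a b : Rbar) (f : R -> R3) : Prop :=
  ~ (exists k : R, forall s : R, in_itv a b s ->
       torsion f s / curvature f s = k).

Definition non_planar (a b : Rbar) (f : R -> R3) : Prop :=
  forall s : R, in_itv a b s -> torsion f s <> 0.

(* The derivatives are with respect to the parameter of f, which is the
   arclength of f for both curves of a Bertrand pair. *)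
Definition admissible_quotients (a b : Rbar) (f : R -> R3) : Prop :=
  forall s : R, in_itv a b s ->
    let k := curvature f s in
    let k' := Derive (curvature f) s in
    let t := torsion f s in
    let t' := Derive (torsion f) s in
    k <> 0 /\ k' <> 0 /\ t / k <> 0 /\ t' / k' <> 0 /\ t / k <> t' / k'.

(* Main.v *)
(* Lancret's theorem says that a curve is a helix iff its unit tangent keeps a
   constant scalar product with a fixed nonzero vector, i.e. iff its tangent
   indicatrix is planar. The unit tangent of the curve T is N, and that of B is
   N up to a sign which is constant because the torsion does not vanish. So
   (i) and (iii) both say that N is planar. *)

Require Import Defs.
From Stdlib Require Import Reals Lra.
From Coquelicot Require Import Coquelicot.
Open Scope R_scope.

(** * Smooth functions on an open interval *)

Lemma locally_in_itv (a b : Rbar) (t : R) :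
  in_itv a b t -> locally t (in_itv a b).
Proof.
  intros [H1 H2].
  exact (filter_and _ _ (open_Rbar_gt' t a H1) (open_Rbar_lt' t b H2)).
Qed.

Lemma locally_eq_in_itv (a b : Rbar) (f h : R -> R) (t : R) :
  (forall x, in_itv a b x -> f x = h x) -> in_itv a b t ->
  locally t (fun x => f x = h x).
Proof.
  intros E Ht; generalize (locally_in_itv a b t Ht).
  apply filter_imp; exact E.
Qed.

(* Functions obtained from derivatives of smooth functions; this class is
   stable under derivation (up to equality on the interval), which makes all of
   its members smooth at once. *)
Inductive smooth_expr (a b : Rbar) : (R -> R) -> Prop :=
| se_base f n : smooth_on a b f -> smooth_expr a b (Derive_n f n)
| se_const k : smooth_expr a b (fun _ => k)
| se_opp f : smooth_expr a b f -> smooth_expr a b (fun t => - f t)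
| se_plus f h : smooth_expr a b f -> smooth_expr a b h ->
    smooth_expr a b (fun t => f t + h t)
| se_mult f h : smooth_expr a b f -> smooth_expr a b h ->
    smooth_expr a b (fun t => f t * h t)
| se_inv f : smooth_expr a b f -> (forall t, in_itv a b t -> f t <> 0) ->
    smooth_expr a b (fun t => / f t)
| se_sqrt f : smooth_expr a b f -> (forall t, in_itv a b t -> 0 < f t) ->
    smooth_expr a b (fun t => sqrt (f t)).

(** Induction on the expression: each differentiation rule leads back into the class, and the side
    conditions of the inverse and the square root make their rules valid at every point of the
    interval. *)
Lemma smooth_expr_derive (a b : Rbar) (f : R -> R) :
  smooth_expr a b f ->
  exists f', smooth_expr a b f' /\
    forall t, in_itv a b t -> is_derive f t (f' t).
Proof.
  induction 1 as [f n Hf | k | f _ [f' [Sf Df]] | f h _ [f' [Sf Df]] _ [h' [Sh Dh]]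
    | f h SEf [f' [Sf Df]] SEh [h' [Sh Dh]]
    | f SEf [f' [Sf Df]] Hf | f SEf [f' [Sf Df]] Hf].
  - exists (Derive_n f (S n)); split; [now constructor |].
    intros t Ht; apply Derive_correct; exact (Hf (S n) t Ht).
  - exists (fun _ => 0); split; [constructor |].
    intros t _; apply (is_derive_const (V := R_NormedModule)).
  - exists (fun t => - f' t); split; [now constructor |].
    intros t Ht; apply (is_derive_opp (V := R_NormedModule)); auto.
  - exists (fun t => f' t + h' t); split; [now constructor |].
    intros t Ht; apply (is_derive_plus (V := R_NormedModule)); auto.
  - exists (fun t => f' t * h t + f t * h' t); split; [now repeat constructor |].
    intros t Ht; apply (is_derive_mult f h); auto.
    exact Rmult_comm.
  (* The derivatives of the inverse and of the square root are written with products and inverses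
     only, so that the constructors apply to them. *)
  - exists (fun t => - (f' t * (/ f t * / f t))); split;
      [now repeat constructor |].
    intros t Ht; evar_last.
    { apply is_derive_inv; [now apply Df | now apply Hf]. }
    specialize (Hf t Ht); field; assumption.
  - exists (fun t => f' t * (/ 2 * / sqrt (f t))); split.
    { repeat constructor; auto.
      intros t Ht; apply Rgt_not_eq, sqrt_lt_R0, Hf, Ht. }
    intros t Ht; evar_last.
    { apply is_derive_sqrt; [now apply Df | now apply Hf]. }
    field; apply Rgt_not_eq, sqrt_lt_R0, Hf, Ht.
Qed.

(** Each iterated derivative agrees on the interval with some member of the class. Since the
    interval is open, this agreement is local and survives another derivation. *)
Lemma smooth_on_expr (a b : Rbar) (f : R -> R) :
  smooth_expr a b f -> smooth_on a b f.
Proof.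
  intros Hf.
  assert (H : forall n, exists h, smooth_expr a b h /\
             forall t, in_itv a b t -> Derive_n f n t = h t).
  { induction n as [| n [h [Sh Eh]]]; [now exists f |].
    destruct (smooth_expr_derive a b h Sh) as [h' [Sh' Dh]].
    exists h'; split; [assumption |].
    intros t Ht; simpl.
    rewrite (Derive_ext_loc _ h) by now apply (locally_eq_in_itv a b).
    now apply is_derive_unique, Dh. }
  (* [ex_derive_n f 0 t] is [True]; order [S n] asks for differentiability of [Derive_n f n]. *)
  intros [| n] t Ht; [exact I |].
  destruct (H n) as [h [Sh Eh]].
  destruct (smooth_expr_derive a b h Sh) as [h' [_ Dh]].
  simpl; apply (ex_derive_ext_loc h).
  - apply (locally_eq_in_itv a b); [intros; symmetry |]; auto.
  - exists (h' t); auto.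
Qed.

Lemma smooth_on_se (a b : Rbar) (f : R -> R) :
  smooth_on a b f -> smooth_expr a b f.
Proof. exact (se_base a b f 0). Qed.

Lemma smooth_on_ex_derive (a b : Rbar) (f : R -> R) (t : R) :
  smooth_on a b f -> in_itv a b t -> ex_derive f t.
Proof. intros H; exact (H 1%nat t). Qed.

Lemma smooth_on_Derive (a b : Rbar) (f : R -> R) :
  smooth_on a b f -> smooth_on a b (Derive f).
Proof. intros H; exact (smooth_on_expr _ _ _ (se_base a b f 1 H)). Qed.

Lemma smooth_on_const (a b : Rbar) (k : R) : smooth_on a b (fun _ => k).
Proof. apply smooth_on_expr; constructor. Qed.

Lemma smooth_on_plus (a b : Rbar) (f h : R -> R) :
  smooth_on a b f -> smooth_on a b h -> smooth_on a b (fun t => f t + h t).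
Proof. intros; apply smooth_on_expr; constructor; now apply smooth_on_se. Qed.

Lemma smooth_on_mult (a b : Rbar) (f h : R -> R) :
  smooth_on a b f -> smooth_on a b h -> smooth_on a b (fun t => f t * h t).
Proof. intros; apply smooth_on_expr; constructor; now apply smooth_on_se. Qed.

Lemma smooth_on_opp (a b : Rbar) (f : R -> R) :
  smooth_on a b f -> smooth_on a b (fun t => - f t).
Proof.
  intros; apply smooth_on_expr; constructor; now apply smooth_on_se.
Qed.

Lemma smooth_on_minus (a b : Rbar) (f h : R -> R) :
  smooth_on a b f -> smooth_on a b h -> smooth_on a b (fun t => f t - h t).
Proof. intros; apply smooth_on_plus; [| apply smooth_on_opp]; assumption. Qed.

Lemma smooth_on_inv (a b : Rbar) (f : R -> R) :
  smooth_on a b f -> (forall t, in_itv a b t -> f t <> 0) ->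
  smooth_on a b (fun t => / f t).
Proof.
  intros; apply smooth_on_expr; constructor; [apply smooth_on_se |]; assumption.
Qed.

Lemma smooth_on_sqrt (a b : Rbar) (f : R -> R) :
  smooth_on a b f -> (forall t, in_itv a b t -> 0 < f t) ->
  smooth_on a b (fun t => sqrt (f t)).
Proof.
  intros; apply smooth_on_expr; constructor; [apply smooth_on_se |]; assumption.
Qed.

(** Convexity in the form suited to [MVT_gen], whose endpoints come in either order. *)
Lemma in_itv_between (a b : Rbar) (x y z : R) :
  in_itv a b x -> in_itv a b y -> Rmin x y <= z <= Rmax x y -> in_itv a b z.
Proof.
  intros [Hax Hxb] [Hay Hyb] [Hz1 Hz2]; split.
  - apply Rbar_lt_le_trans with (Rmin x y); [| exact Hz1].
    unfold Rmin; destruct (Rle_dec x y); assumption.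
  - apply Rbar_le_lt_trans with (Rmax x y); [exact Hz2 |].
    unfold Rmax; destruct (Rle_dec x y); assumption.
Qed.

Lemma Derive_zero_const (a b : Rbar) (f : R -> R) :
  smooth_on a b f -> (forall t, in_itv a b t -> Derive f t = 0) ->
  forall x y, in_itv a b x -> in_itv a b y -> f x = f y.
Proof.
  intros Hf Hd x y Hx Hy.
  assert (HD : forall z, Rmin x y <= z <= Rmax x y -> is_derive f z 0).
  { intros z Hz; pose proof (in_itv_between a b x y z Hx Hy Hz) as Hz'.
    rewrite <- (Hd z Hz'); apply Derive_correct.
    now apply (smooth_on_ex_derive a b). }
  destruct (MVT_gen f x y (fun _ => 0)) as [z [_ Hz]]; simpl in *.
  - intros z Hz; apply HD; lra.
  - intros z Hz; apply continuity_pt_filterlim.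
    apply (ex_derive_continuous f); exists 0; auto.
  - lra.
Qed.

Lemma Derive_const_zero (a b : Rbar) (f : R -> R) (k : R) :
  (forall t, in_itv a b t -> f t = k) ->
  forall t, in_itv a b t -> Derive f t = 0.
Proof.
  intros E t Ht; rewrite (Derive_ext_loc f (fun _ => k)).
  - apply Derive_const.
  - now apply (locally_eq_in_itv a b).
Qed.

(** Supplies the base point at which quantities shown to be constant are evaluated. *)
Lemma Rbar_lt_in_itv (a b : Rbar) : Rbar_lt a b -> exists t, in_itv a b t.
Proof.
  unfold in_itv; destruct a as [a | |], b as [b | |]; simpl; intros H;
    try contradiction.
  - exists ((a + b) / 2); lra.
  - exists (a + 1); split; [lra | exact I].
  - exists (b - 1); split; [exact I | lra].
  - exists 0; now split.
Qed.

(** * Vector calculus *)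

Lemma R3_ext (u v : R3) : px u = px v -> py u = py v -> pz u = pz v -> u = v.
Proof.
  destruct u as [[u1 u2] u3], v as [[v1 v2] v3]; unfold px, py, pz; simpl.
  congruence.
Qed.

Lemma dot_sym (u v : R3) : dot u v = dot v u.
Proof. unfold dot; ring. Qed.

Lemma dot_scal_l (k : R) (u v : R3) : dot (scal k u) v = k * dot u v.
Proof.
  unfold dot.
  change (k * px u * px v + k * py u * py v + k * pz u * pz v
    = k * (px u * px v + py u * py v + pz u * pz v)); ring.
Qed.

Lemma dot_scal_r (k : R) (u v : R3) : dot u (scal k v) = k * dot u v.
Proof. rewrite dot_sym, dot_scal_l, dot_sym; reflexivity. Qed.

Lemma dot_plus_l (u v w : R3) : dot (plus u v) w = dot u w + dot v w.
Proof.
  unfold dot.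
  change ((px u + px v) * px w + (py u + py v) * py w + (pz u + pz v) * pz w
    = px u * px w + py u * py w + pz u * pz w
      + (px v * px w + py v * py w + pz v * pz w)); ring.
Qed.

Lemma dot_plus_r (u v w : R3) : dot w (plus u v) = dot w u + dot w v.
Proof. rewrite dot_sym, dot_plus_l, !(dot_sym w); reflexivity. Qed.

Lemma dot_zero_l (v : R3) : dot (0, 0, 0) v = 0.
Proof. unfold dot, px, py, pz; simpl; ring. Qed.

Lemma dot_cross_l (u v : R3) : dot u (cross u v) = 0.
Proof. unfold dot, cross, px, py, pz; simpl; ring. Qed.

Lemma dot_cross_r (u v : R3) : dot v (cross u v) = 0.
Proof. unfold dot, cross, px, py, pz; simpl; ring. Qed.

Lemma dot_cross_self (u v : R3) :
  dot (cross u v) (cross u v) = dot u u * dot v v - dot u v * dot u v.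
Proof. unfold dot, cross, px, py, pz; simpl; ring. Qed.

Lemma dot_self_nonneg (u : R3) : 0 <= dot u u.
Proof.
  unfold dot.
  pose proof (Rle_0_sqr (px u)); pose proof (Rle_0_sqr (py u)).
  pose proof (Rle_0_sqr (pz u)); unfold Rsqr in *; lra.
Qed.

Lemma vnorm_sqr (u : R3) : vnorm u * vnorm u = dot u u.
Proof. apply sqrt_sqrt, dot_self_nonneg. Qed.

Lemma dot_self_pos (u : R3) : vnorm u <> 0 -> 0 < dot u u.
Proof.
  intros H; destruct (dot_self_nonneg u) as [Hu | Hu]; [exact Hu |].
  destruct H; unfold vnorm; rewrite <- Hu; apply sqrt_0.
Qed.

(** A vector of length zero has zero coordinates. Speeds and curvatures are shown below not to
    vanish by testing a derivative against a well-chosen frame vector. *)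
Lemma vnorm_neq0_dot (u v : R3) : dot u v <> 0 -> vnorm u <> 0.
Proof.
  intros H H0; apply H; pose proof (vnorm_sqr u) as E; rewrite H0 in E.
  pose proof (Rle_0_sqr (px u)); pose proof (Rle_0_sqr (py u)).
  pose proof (Rle_0_sqr (pz u)).
  unfold dot in *; unfold Rsqr in *.
  assert (px u = 0) by (apply Rsqr_0_uniq; unfold Rsqr; lra).
  assert (py u = 0) by (apply Rsqr_0_uniq; unfold Rsqr; lra).
  assert (pz u = 0) by (apply Rsqr_0_uniq; unfold Rsqr; lra).
  replace (px u) with 0; replace (py u) with 0; replace (pz u) with 0; ring.
Qed.

Lemma dot_normalize (u : R3) :
  vnorm u <> 0 -> dot (scal (/ vnorm u) u) (scal (/ vnorm u) u) = 1.
Proof.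
  intros H; rewrite dot_scal_l, dot_scal_r, <- vnorm_sqr; field; exact H.
Qed.

Lemma scal_normalize (u : R3) :
  vnorm u <> 0 -> u = scal (vnorm u) (scal (/ vnorm u) u).
Proof.
  intros H; rewrite scal_assoc.
  change (mult (vnorm u) (/ vnorm u)) with (vnorm u * / vnorm u).
  rewrite Rinv_r by exact H.
  symmetry; apply (scal_one u).
Qed.

Lemma orthonormal_expand (T N w : R3) :
  dot T T = 1 -> dot N N = 1 -> dot T N = 0 ->
  w = plus (plus (scal (dot w T) T) (scal (dot w N) N))
           (scal (dot w (cross T N)) (cross T N)).
Proof.
  intros HT HN HTN.
  (* The identity behind it, valid without orthonormality, is the expansion of
     [w] times the Gram determinant of [T] and [N]. *)
  assert (G : scal (dot T T * dot N N - dot T N * dot T N) w =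
     plus (plus (scal (dot w T * dot N N - dot w N * dot T N) T)
                (scal (dot w N * dot T T - dot w T * dot T N) N))
          (scal (dot w (cross T N)) (cross T N))).
  { destruct T as [[T1 T2] T3], N as [[N1 N2] N3], w as [[w1 w2] w3].
    apply R3_ext; unfold dot, cross, px, py, pz, scal, plus; simpl;
      unfold scal, plus, mult; simpl; unfold mult; simpl; ring. }
  rewrite HT, HN, HTN in G.
  replace (1 * 1 - 0 * 0) with 1 in G by ring.
  replace (dot w T * 1 - dot w N * 0) with (dot w T) in G by ring.
  replace (dot w N * 1 - dot w T * 0) with (dot w N) in G by ring.
  rewrite <- G; symmetry; apply (scal_one w).
Qed.

Lemma smooth_on_dot (a b : Rbar) (f h : R -> R3) :
  vsmooth_on a b f -> vsmooth_on a b h ->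
  smooth_on a b (fun t => dot (f t) (h t)).
Proof.
  intros [F1 [F2 F3]] [H1 [H2 H3]].
  apply smooth_on_plus; [apply smooth_on_plus |];
    apply smooth_on_mult; assumption.
Qed.

Lemma vsmooth_on_const (a b : Rbar) (u : R3) : vsmooth_on a b (fun _ => u).
Proof. repeat split; apply smooth_on_const. Qed.

Lemma vsmooth_on_scal (a b : Rbar) (h : R -> R) (f : R -> R3) :
  smooth_on a b h -> vsmooth_on a b f ->
  vsmooth_on a b (fun t => scal (h t) (f t)).
Proof.
  intros Hh [F1 [F2 F3]].
  split; [| split]; now apply (smooth_on_mult a b h).
Qed.

Lemma vsmooth_on_cross (a b : Rbar) (f h : R -> R3) :
  vsmooth_on a b f -> vsmooth_on a b h ->
  vsmooth_on a b (fun t => cross (f t) (h t)).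
Proof.
  intros [F1 [F2 F3]] [H1 [H2 H3]].
  split; [| split]; apply smooth_on_minus; now apply smooth_on_mult.
Qed.

Lemma vsmooth_on_vderive (a b : Rbar) (f : R -> R3) :
  vsmooth_on a b f -> vsmooth_on a b (vderive f).
Proof.
  intros [F1 [F2 F3]].
  split; [| split]; now apply (smooth_on_Derive a b).
Qed.

Lemma smooth_on_vnorm (a b : Rbar) (f : R -> R3) :
  vsmooth_on a b f -> (forall t, in_itv a b t -> vnorm (f t) <> 0) ->
  smooth_on a b (fun t => vnorm (f t)).
Proof.
  intros Hf H; apply smooth_on_sqrt.
  - now apply smooth_on_dot.
  - intros t Ht; now apply dot_self_pos, H.
Qed.

Lemma Derive_dot (a b : Rbar) (f h : R -> R3) (t : R) :
  vsmooth_on a b f -> vsmooth_on a b h -> in_itv a b t ->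
  Derive (fun x => dot (f x) (h x)) t =
    dot (vderive f t) (h t) + dot (f t) (vderive h t).
Proof.
  intros [F1 [F2 F3]] [H1 [H2 H3]] Ht.
  unfold dot.
  pose proof (fun f Hf => smooth_on_ex_derive a b f t Hf Ht) as ED.
  rewrite !Derive_plus, !Derive_mult; auto using smooth_on_plus, smooth_on_mult.
  unfold vderive, px, py, pz; simpl; ring.
Qed.

Lemma Derive_dot_const (a b : Rbar) (f : R -> R3) (u : R3) (t : R) :
  vsmooth_on a b f -> in_itv a b t ->
  Derive (fun x => dot u (f x)) t = dot u (vderive f t).
Proof.
  intros Hf Ht.
  rewrite (Derive_dot a b (fun _ => u) f t (vsmooth_on_const a b u) Hf Ht).
  replace (vderive (fun _ : R => u) t) with ((0, 0, 0) : R3).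
  - rewrite dot_zero_l; ring.
  - unfold vderive; rewrite !Derive_const; reflexivity.
Qed.

(** The product rule applied to a constant. This is the source of the skew-symmetry of the Frenet
    matrix; for [f = h] it makes a field of constant length orthogonal to its derivative. *)
Lemma dot_const_vderive (a b : Rbar) (f h : R -> R3) (k t : R) :
  vsmooth_on a b f -> vsmooth_on a b h ->
  (forall x, in_itv a b x -> dot (f x) (h x) = k) -> in_itv a b t ->
  dot (vderive f t) (h t) = - dot (vderive h t) (f t).
Proof.
  intros Hf Hh E Ht.
  pose proof (Derive_dot a b f h t Hf Hh Ht) as D.
  rewrite (Derive_const_zero a b _ k E t Ht) in D.
  rewrite (dot_sym (vderive h t)); lra.
Qed.

(** * Frenet apparatus *)

Lemma curve_vnorm_tangent' (a b : Rbar) (f : R -> R3) (t : R) :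
  curve a b f -> in_itv a b t -> vnorm (vderive (tangent f) t) <> 0.
Proof.
  intros [_ [_ Hk]] Ht E; apply (Hk t Ht); unfold curvature.
  rewrite E; unfold Rdiv; ring.
Qed.

Lemma vsmooth_on_tangent (a b : Rbar) (f : R -> R3) :
  curve a b f -> vsmooth_on a b (tangent f).
Proof.
  intros [Hf [Hv _]].
  pose proof (vsmooth_on_vderive a b f Hf) as Hf'.
  apply vsmooth_on_scal; [| exact Hf'].
  apply smooth_on_inv; [| exact Hv].
  now apply smooth_on_vnorm.
Qed.

Lemma vsmooth_on_normal (a b : Rbar) (f : R -> R3) :
  curve a b f -> vsmooth_on a b (normal f).
Proof.
  intros Hc.
  pose proof (vsmooth_on_vderive a b _ (vsmooth_on_tangent a b f Hc)) as HT'.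
  pose proof (fun t => curve_vnorm_tangent' a b f t Hc) as H0.
  apply vsmooth_on_scal; [| exact HT'].
  apply smooth_on_inv; [| exact H0].
  now apply smooth_on_vnorm.
Qed.

Lemma vsmooth_on_binormal (a b : Rbar) (f : R -> R3) :
  curve a b f -> vsmooth_on a b (binormal f).
Proof.
  intros Hc; apply vsmooth_on_cross.
  - now apply vsmooth_on_tangent.
  - now apply vsmooth_on_normal.
Qed.

Lemma dot_tangent_self (a b : Rbar) (f : R -> R3) (t : R) :
  curve a b f -> in_itv a b t -> dot (tangent f t) (tangent f t) = 1.
Proof. intros [_ [Hv _]] Ht; now apply dot_normalize, Hv. Qed.

Lemma dot_normal_self (a b : Rbar) (f : R -> R3) (t : R) :
  curve a b f -> in_itv a b t -> dot (normal f t) (normal f t) = 1.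
Proof.
  intros Hc Ht; apply dot_normalize; now apply (curve_vnorm_tangent' a b).
Qed.

(** The normal is a multiple of the derivative of the unit field [tangent f]. *)
Lemma dot_tangent_normal (a b : Rbar) (f : R -> R3) (t : R) :
  curve a b f -> in_itv a b t -> dot (tangent f t) (normal f t) = 0.
Proof.
  intros Hc Ht; unfold normal; rewrite dot_scal_r, dot_sym.
  pose proof (vsmooth_on_tangent a b f Hc) as HT.
  pose proof (dot_const_vderive a b _ _ 1 t HT HT
    (fun x => dot_tangent_self a b f x Hc) Ht) as E.
  replace (dot (vderive (tangent f) t) (tangent f t)) with 0 by lra; ring.
Qed.

Lemma dot_binormal_self (a b : Rbar) (f : R -> R3) (t : R) :
  curve a b f -> in_itv a b t -> dot (binormal f t) (binormal f t) = 1.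
Proof.
  intros Hc Ht; unfold binormal; rewrite dot_cross_self.
  rewrite (dot_tangent_self a b f t Hc Ht), (dot_normal_self a b f t Hc Ht).
  rewrite (dot_tangent_normal a b f t Hc Ht); ring.
Qed.

(** The definition of the normal, solved for the derivative. In the three Frenet formulas the factor
    [speed f t] accounts for a parameter that need not be arclength. *)
Lemma frenet_tangent (a b : Rbar) (f : R -> R3) (t : R) :
  curve a b f -> in_itv a b t ->
  vderive (tangent f) t = scal (speed f t * curvature f t) (normal f t).
Proof.
  intros Hc Ht.
  replace (speed f t * curvature f t) with (vnorm (vderive (tangent f) t)).
  - apply scal_normalize; now apply (curve_vnorm_tangent' a b).
  - unfold curvature; field; now apply Hc.
Qed.

(** In the Frenet frame, the component of $B'$ along $T$ vanishes because $T'$ is parallel to $N$,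
    the one along $B$ because $B$ is a unit field, and the one along $N$ is the definition of the
    torsion. *)
Lemma frenet_binormal (a b : Rbar) (f : R -> R3) (t : R) :
  curve a b f -> in_itv a b t ->
  vderive (binormal f) t = scal (- (speed f t * torsion f t)) (normal f t).
Proof.
  intros Hc Ht.
  pose proof (vsmooth_on_tangent a b f Hc) as HT.
  pose proof (vsmooth_on_binormal a b f Hc) as HB.
  rewrite (orthonormal_expand (tangent f t) (normal f t)
    (vderive (binormal f) t)
    (dot_tangent_self a b f t Hc Ht) (dot_normal_self a b f t Hc Ht)
    (dot_tangent_normal a b f t Hc Ht)).
  fold (binormal f t).
  assert (E1 : dot (vderive (binormal f) t) (tangent f t) = 0).
  { rewrite (dot_const_vderive a b _ _ 0 t HB HT); [| | exact Ht].
    - rewrite (frenet_tangent a b f t Hc Ht), dot_scal_l.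
      unfold binormal; rewrite dot_cross_r; ring.
    - intros x _; rewrite dot_sym; apply dot_cross_l. }
  assert (E2 : dot (vderive (binormal f) t) (binormal f t) = 0).
  { pose proof (dot_const_vderive a b _ _ 1 t HB HB
      (fun x => dot_binormal_self a b f x Hc) Ht); lra. }
  rewrite E1, E2, !(scal_zero_l (K := R_Ring)), plus_zero_l, plus_zero_r.
  f_equal; unfold torsion; field; now apply Hc.
Qed.

(** By skew-symmetry, the components of $N'$ along $T$ and $B$ are read off the other two Frenet
    formulas. *)
Lemma frenet_normal (a b : Rbar) (f : R -> R3) (t : R) :
  curve a b f -> in_itv a b t ->
  vderive (normal f) t =
    plus (scal (- (speed f t * curvature f t)) (tangent f t))
         (scal (speed f t * torsion f t) (binormal f t)).
Proof.
  intros Hc Ht.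
  pose proof (vsmooth_on_tangent a b f Hc) as HT.
  pose proof (vsmooth_on_normal a b f Hc) as HN.
  pose proof (vsmooth_on_binormal a b f Hc) as HB.
  pose proof (dot_normal_self a b f t Hc Ht) as N1.
  rewrite (orthonormal_expand (tangent f t) (normal f t) (vderive (normal f) t)
    (dot_tangent_self a b f t Hc Ht) N1 (dot_tangent_normal a b f t Hc Ht)).
  fold (binormal f t).
  assert (E1 : dot (vderive (normal f) t) (tangent f t)
               = - (speed f t * curvature f t)).
  { rewrite (dot_const_vderive a b _ _ 0 t HN HT); [| | exact Ht].
    - rewrite (frenet_tangent a b f t Hc Ht), dot_scal_l, N1; ring.
    - intros x Hx; rewrite dot_sym; now apply (dot_tangent_normal a b). }
  assert (E2 : dot (vderive (normal f) t) (normal f t) = 0).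
  { pose proof (dot_const_vderive a b _ _ 1 t HN HN
      (fun x => dot_normal_self a b f x Hc) Ht); lra. }
  assert (E3 : dot (vderive (normal f) t) (binormal f t)
               = speed f t * torsion f t).
  { rewrite (dot_const_vderive a b _ _ 0 t HN HB); [| | exact Ht].
    - rewrite (frenet_binormal a b f t Hc Ht), dot_scal_l, N1; ring.
    - intros x _; apply dot_cross_r. }
  rewrite E1, E2, E3, (scal_zero_l (K := R_Ring)), plus_zero_r; reflexivity.
Qed.

(** This component is minus speed times curvature. It will show that the tangent and binormal
    indicatrices have non-vanishing curvature. *)
Lemma dot_vderive_normal_tangent (a b : Rbar) (f : R -> R3) (t : R) :
  curve a b f -> in_itv a b t ->
  dot (vderive (normal f) t) (tangent f t) <> 0.
Proof.
  intros Hc Ht; rewrite (frenet_normal a b f t Hc Ht).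
  rewrite dot_plus_l, !dot_scal_l, (dot_tangent_self a b f t Hc Ht).
  rewrite (dot_sym (binormal f t)); unfold binormal; rewrite dot_cross_l.
  destruct Hc as [_ [Hv Hk]].
  pose proof (Rmult_integral_contrapositive_currified _ _ (Hv t Ht) (Hk t Ht)).
  lra.
Qed.

(** * Helices *)

(** A constant ratio $k$ makes $kT+B$ a fixed axis. Conversely, if $u \cdot T$ is constant, then $u
    \cdot N = 0$, so $u \cdot B$ is constant too, and $u \cdot N' = 0$ becomes a linear relation
    between curvature and torsion with constant coefficients. *)
Lemma lancret (a b : Rbar) (f : R -> R3) :
  Rbar_lt a b -> curve a b f -> (helix a b f <-> planar a b (tangent f)).
Proof.
  intros Hab Hc; destruct (Rbar_lt_in_itv a b Hab) as [t0 Ht0].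
  pose proof (vsmooth_on_tangent a b f Hc) as HT.
  pose proof (vsmooth_on_normal a b f Hc) as HN.
  pose proof (vsmooth_on_binormal a b f Hc) as HB.
  assert (Hv := proj1 (proj2 Hc)); assert (Hk := proj2 (proj2 Hc)).
  split.
  - intros [_ [k Ek]].
    (* The axis is [k T + B], which has zero derivative; it is taken at [t0]. *)
    pose (u := plus (scal k (tangent f t0)) (binormal f t0)).
    (* Constancy of the axis is tested against an arbitrary [w], so that only real functions are
       differentiated. *)
    assert (Hu : forall w t, in_itv a b t ->
              k * dot w (tangent f t) + dot w (binormal f t) = dot w u).
    { intros w t Ht; unfold u; rewrite dot_plus_r, dot_scal_r.
      assert (ST : smooth_on a b (fun x => dot w (tangent f x))).
      { apply smooth_on_dot; [apply vsmooth_on_const | exact HT]. }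
      assert (SB : smooth_on a b (fun x => dot w (binormal f x))).
      { apply smooth_on_dot; [apply vsmooth_on_const | exact HB]. }
      apply (Derive_zero_const a b
        (fun x => k * dot w (tangent f x) + dot w (binormal f x)));
        [| | exact Ht | exact Ht0].
      - apply smooth_on_plus; [| exact SB].
        apply smooth_on_mult; [apply smooth_on_const | exact ST].
      - intros x Hx; rewrite Derive_plus, Derive_scal.
        + rewrite !(Derive_dot_const a b) by assumption.
          rewrite (frenet_tangent a b f x Hc Hx).
          rewrite (frenet_binormal a b f x Hc Hx), !dot_scal_r.
          rewrite <- (Ek x Hx); field; now apply Hk.
        + apply (smooth_on_ex_derive a b); [| exact Hx].
          apply smooth_on_mult; [apply smooth_on_const | exact ST].
        + now apply (smooth_on_ex_derive a b). }
    exists u, k; split.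
    (* The axis has scalar product 1 with the binormal at [t0], hence is not zero. *)
    + intros E; pose proof (Hu (binormal f t0) t0 Ht0) as E0.
      rewrite (dot_binormal_self a b f t0 Hc Ht0), E in E0.
      rewrite (dot_sym _ (0, 0, 0)), dot_zero_l, dot_sym in E0.
      unfold binormal in E0; rewrite dot_cross_l in E0; lra.
    + intros t Ht; rewrite dot_sym, <- (Hu (tangent f t) t Ht).
      rewrite (dot_tangent_self a b f t Hc Ht).
      unfold binormal; rewrite dot_cross_l; ring.
  - intros [u [k [Hu Ek]]]; split; [exact Hc |].
    assert (EN : forall t, in_itv a b t -> dot u (normal f t) = 0).
    { intros t Ht; pose proof (Derive_const_zero a b _ k Ek t Ht) as D.
      rewrite (Derive_dot_const a b _ u t HT Ht) in D.
      rewrite (frenet_tangent a b f t Hc Ht), dot_scal_r in D.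
      apply Rmult_integral in D; destruct D as [D | D]; [| exact D].
      apply Rmult_integral in D.
      destruct D as [D | D]; [now destruct (Hv t Ht) | now destruct (Hk t Ht)]. }
    assert (EB : forall t, in_itv a b t ->
              dot u (binormal f t) = dot u (binormal f t0)).
    { intros t Ht.
      apply (Derive_zero_const a b (fun x => dot u (binormal f x)));
        [| | exact Ht | exact Ht0].
      - apply smooth_on_dot; [apply vsmooth_on_const | exact HB].
      - intros x Hx; rewrite (Derive_dot_const a b _ u x HB Hx).
        rewrite (frenet_binormal a b f x Hc Hx), dot_scal_r, (EN x Hx); ring. }
    (* This is the derivative of $u \cdot N = 0$, divided by the speed. *)
    assert (ER : forall t, in_itv a b t ->
              torsion f t * dot u (binormal f t0) = curvature f t * k).
    { intros t Ht; pose proof (Derive_const_zero a b _ 0 EN t Ht) as D.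
      rewrite (Derive_dot_const a b _ u t HN Ht) in D.
      rewrite (frenet_normal a b f t Hc Ht), dot_plus_r, !dot_scal_r in D.
      rewrite (Ek t Ht), (EB t Ht) in D.
      apply Rmult_eq_reg_l with (speed f t); [lra | now apply Hv]. }
    (* Otherwise the relation at [t0] forces [k = 0], since the curvature is not zero; then [u] is
       orthogonal to the whole frame and vanishes. *)
    assert (HcB : dot u (binormal f t0) <> 0).
    { intros E; pose proof (ER t0 Ht0) as R0; rewrite E, Rmult_0_r in R0.
      symmetry in R0; apply Rmult_integral in R0.
      destruct R0 as [R0 | R0]; [now destruct (Hk t0 Ht0) |].
      apply Hu; rewrite (orthonormal_expand (tangent f t0) (normal f t0) u
        (dot_tangent_self a b f t0 Hc Ht0) (dot_normal_self a b f t0 Hc Ht0)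
        (dot_tangent_normal a b f t0 Hc Ht0)).
      fold (binormal f t0); rewrite E, (EN t0 Ht0), (Ek t0 Ht0), R0.
      rewrite !(scal_zero_l (K := R_Ring)), !plus_zero_l; reflexivity. }
    exists (k / dot u (binormal f t0)); intros t Ht.
    pose proof (ER t Ht) as E; pose proof (Hk t Ht) as Hkt.
    apply Rmult_eq_reg_r with (curvature f t * dot u (binormal f t0)).
    + field_simplify; [lra | assumption | assumption].
    + now apply Rmult_integral_contrapositive_currified.
Qed.

(** * The tangent and binormal indicatrices as curves *)

(** The unit tangent of the curve $T$ is $N$ by mere unfolding, and its derivative $N'$ has a
    nonzero component along $T$. *)
Lemma curve_tangent (a b : Rbar) (f : R -> R3) :
  curve a b f -> curve a b (tangent f).
Proof.
  intros Hc; split; [now apply vsmooth_on_tangent | split].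
  - intros t Ht; now apply (curve_vnorm_tangent' a b).
  - intros t Ht; unfold curvature.
    apply Rmult_integral_contrapositive_currified.
    + change (tangent (tangent f)) with (normal f).
      apply (vnorm_neq0_dot _ (tangent f t)).
      now apply (dot_vderive_normal_tangent a b).
    + apply Rinv_neq_0_compat; now apply (curve_vnorm_tangent' a b).
Qed.

Lemma speed_binormal_neq0 (a b : Rbar) (f : R -> R3) :
  curve a b f -> non_planar a b f ->
  forall t, in_itv a b t -> speed (binormal f) t <> 0.
Proof.
  intros Hc Ht0 t Ht; apply (vnorm_neq0_dot _ (normal f t)).
  rewrite (frenet_binormal a b f t Hc Ht), dot_scal_l.
  rewrite (dot_normal_self a b f t Hc Ht), Rmult_1_r.
  apply Ropp_neq_0_compat, Rmult_integral_contrapositive_currified.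
  - now apply Hc.
  - now apply Ht0.
Qed.

Lemma vsmooth_on_tangent_binormal (a b : Rbar) (f : R -> R3) :
  curve a b f -> non_planar a b f -> vsmooth_on a b (tangent (binormal f)).
Proof.
  intros Hc Hp.
  pose proof (vsmooth_on_vderive a b _ (vsmooth_on_binormal a b f Hc)) as HB'.
  pose proof (speed_binormal_neq0 a b f Hc Hp) as H0.
  apply vsmooth_on_scal; [| exact HB'].
  apply smooth_on_inv; [| exact H0].
  now apply smooth_on_vnorm.
Qed.

(** The factor is the sign of minus the torsion. It is obtained as the scalar product [h] with the
    normal, which is visibly smooth; only [e <> 0] is recorded, as this suffices to transfer
    planarity. *)
Lemma tangent_binormal (a b : Rbar) (f : R -> R3) :
  Rbar_lt a b -> curve a b f -> non_planar a b f ->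
  exists e, e <> 0 /\ forall t, in_itv a b t ->
    tangent (binormal f) t = scal e (normal f t).
Proof.
  intros Hab Hc Hp; destruct (Rbar_lt_in_itv a b Hab) as [t0 Ht0].
  pose proof (vsmooth_on_tangent_binormal a b f Hc Hp) as HS.
  pose proof (vsmooth_on_normal a b f Hc) as HN.
  pose (h := fun t => dot (tangent (binormal f) t) (normal f t)).
  assert (Sh : smooth_on a b h) by now apply smooth_on_dot.
  assert (Eh : forall t, in_itv a b t ->
            tangent (binormal f) t = scal (h t) (normal f t)).
  { intros t Ht; unfold h, tangent at 1 2.
    rewrite (frenet_binormal a b f t Hc Ht), !dot_scal_l.
    rewrite (dot_normal_self a b f t Hc Ht), scal_assoc.
    apply (f_equal (fun k => scal k (normal f t))).
    unfold mult; simpl; ring. }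
  (* [h t * h t] is the squared length of a unit tangent. *)
  assert (Hh : forall t, in_itv a b t -> h t * h t = 1).
  { intros t Ht.
    pose proof (dot_normalize _ (speed_binormal_neq0 a b f Hc Hp t Ht)) as E.
    change (dot (tangent (binormal f) t) (tangent (binormal f) t) = 1) in E.
    rewrite (Eh t Ht), dot_scal_l, dot_scal_r in E.
    rewrite (dot_normal_self a b f t Hc Ht) in E; lra. }
  exists (h t0); split.
  - intros E; pose proof (Hh t0 Ht0) as H; rewrite E in H; lra.
  - intros t Ht; rewrite (Eh t Ht); f_equal.
    (* [h] is a smooth sign: differentiating [h ^ 2 = 1] gives [h h' = 0]. *)
    apply (Derive_zero_const a b h Sh); [| exact Ht | exact Ht0].
    intros x Hx; pose proof (Derive_const_zero a b _ 1 Hh x Hx) as D.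
    rewrite Derive_mult in D by now apply (smooth_on_ex_derive a b).
    assert (D2 : Derive h x * h x = 0) by lra.
    apply Rmult_integral in D2; destruct D2 as [D2 | D2]; [exact D2 |].
    pose proof (Hh x Hx) as H; rewrite D2 in H; lra.
Qed.

Lemma planar_scal (a b : Rbar) (e : R) (f h : R -> R3) :
  e <> 0 -> (forall t, in_itv a b t -> h t = scal e (f t)) ->
  (planar a b f <-> planar a b h).
Proof.
  intros He E; split; intros [u [k [Hu Ek]]].
  - exists u, (e * k); split; [exact Hu |].
    intros t Ht; rewrite (E t Ht), dot_scal_r, (Ek t Ht); reflexivity.
  - exists u, (k / e); split; [exact Hu |].
    intros t Ht; rewrite <- (Ek t Ht), (E t Ht), dot_scal_r; field; exact He.
Qed.

(** The unit tangent of $B$ is $eN$, with derivative $eN'$, whose component along $T$ is not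
    zero. *)
Lemma curve_binormal (a b : Rbar) (f : R -> R3) :
  Rbar_lt a b -> curve a b f -> non_planar a b f -> curve a b (binormal f).
Proof.
  intros Hab Hc Hp.
  pose proof (speed_binormal_neq0 a b f Hc Hp) as Hv.
  split; [now apply vsmooth_on_binormal | split; [exact Hv |]].
  destruct (tangent_binormal a b f Hab Hc Hp) as [e [He Ee]].
  pose proof (vsmooth_on_tangent_binormal a b f Hc Hp) as HS.
  pose proof (vsmooth_on_normal a b f Hc) as HN.
  intros t Ht; unfold curvature; apply Rmult_integral_contrapositive_currified.
  - apply (vnorm_neq0_dot _ (tangent f t)).
    (* The test vector is frozen at [t]; the unit tangent of $B$ is known to be $eN$ only on the
       interval, so the derivatives are compared by local equality. *)
    assert (D : Derive (fun x => dot (tangent f t) (tangent (binormal f) x)) t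
              = e * dot (tangent f t) (vderive (normal f) t)).
    { rewrite <- (Derive_dot_const a b _ _ t HN Ht), <- Derive_scal.
      apply Derive_ext_loc, (locally_eq_in_itv a b); [| exact Ht].
      intros x Hx; rewrite (Ee x Hx), dot_scal_r; reflexivity. }
    rewrite (Derive_dot_const a b _ _ t HS Ht) in D.
    rewrite dot_sym, D, dot_sym.
    apply Rmult_integral_contrapositive_currified; [exact He |].
    now apply (dot_vderive_normal_tangent a b).
  - now apply Rinv_neq_0_compat, Hv.
Qed.

Theorem corollary15 (a b c d : Rbar) (g g' : R -> R3)
    (Hab : Rbar_lt a b) (Hcd : Rbar_lt c d)
    (Hpair : bertrand_pair a b g c d g')
    (Hnh : non_helical a b g) (Hnh' : non_helical c d g')
    (Hnp : non_planar a b g) (Hnp' : non_planar c d g')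
    (Hq : admissible_quotients a b g) (Hq' : admissible_quotients c d g') :
  (spherical_helix a b (tangent g) <-> planar a b (normal g)) /\
  (planar a b (normal g) <-> spherical_helix a b (binormal g)).
Proof.
  destruct Hpair as [[Hc _] _].
  destruct (tangent_binormal a b g Hab Hc Hnp) as [e [He Ee]].
  pose proof (lancret a b (tangent g) Hab (curve_tangent a b g Hc)) as LT.
  pose proof (lancret a b (binormal g) Hab (curve_binormal a b g Hab Hc Hnp))
    as LB.
  rewrite <- (planar_scal a b e (normal g) _ He Ee) in LB.
  change (tangent (tangent g)) with (normal g) in LT.
  (* $T$ and $B$ are unit fields, so the spherical condition holds for both and only the helix
     condition remains. *)
  assert (ST : forall t, in_itv a b t -> vnorm (tangent g t) = 1).
  { intros t Ht; unfold vnorm; rewrite (dot_tangent_self a b g t Hc Ht).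
    apply sqrt_1. }
  assert (SB : forall t, in_itv a b t -> vnorm (binormal g t) = 1).
  { intros t Ht; unfold vnorm; rewrite (dot_binormal_self a b g t Hc Ht).
    apply sqrt_1. }
  unfold spherical_helix; tauto.
Qed.
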